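(* Let $k\ge0$ be an integer and let $H$ be a linear subspace of $E^*$ with $\operatorname{im} d\subseteq H$ and $\dim H=\operatorname{rank}(d)+k$. Let $\theta_1,\dots,\theta_k\in E^*$ be such that $H=\operatorname{im} d\oplus\mathrm{Vect}(\theta_1,\dots,\theta_k)$ and set $\vartheta=\theta_1\wedge\dots\wedge\theta_k$. Let $Y$ be a determinantal random subset of $S$ associated to $H$ in the orthonormal basis $(e_i^\star/\sqrt{x_i})_{i\in S}$ of $E^*$. Then $Y$ belongs to $\mathcal B_k(\mathcal M)$ almost surely and, for every $K\in\mathcal B_k(\mathcal M)$, $$\mathbb P(Y=K)=\frac{w(K)\,\underline x^K}{L_k(\vartheta,\underline x)}=\frac{w(T)\,|(\vartheta,\det\mathscr Z^K_T)|^2\,\underline x^K}{L_k(\vartheta,\underline x)},$$ where $T$ is any basis of $\mathcal M$ contained in $K$, and $L_k(\vartheta,\underline x)=\sum_{K'\in\mathcal B_k(\mathcal M)}w(K')\,\underline x^{K'}$.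
   Context: Let $\mathbb K=\mathbb R$ or $\mathbb C$, $S=\{1,\dots,s\}$, $E$ an $s$-dimensional $\mathbb K$-vector space with basis $(e_i)_{i\in S}$, $F$ a finite-dimensional $\mathbb K$-vector space, and $\partial:E\to F$ a linear map. Let $\mathcal M$ be the linear matroid on $S$ whose independent sets are the $I\subseteq S$ such that $\{\partial(e_i):i\in I\}$ is linearly independent; $\mathcal B(\mathcal M)$ is its set of bases, $n=\operatorname{rank}\partial$ its rank, $Z=\ker\partial$, $b=\dim Z=s-n$. $\mathcal B_k(\mathcal M)$ is the set of subsets of $S$ of cardinality $n+k$ which contain a basis of $\mathcal M$. For $J\subseteq S$, $E_J=\mathrm{Vect}(e_j:j\in J)$, and $Z_K=Z\cap E_K$. For $T\in\mathcal B(\mathcal M)$ one has $E=E_T\oplus Z$, and $\mathsf Z_T:E\to Z$ is the corresponding projection. For $K\in\mathcal B_k(\mathcal M)$ containing $T$, $\mathscr Z^K_T=(\mathsf Z_T(e_j):j\in K\setminus T)$, ordered by the order of $S$, is a basis of $Z_K$, and $\det\mathscr Z^K_T$ is the exterior product of its elements. If $\mathscr Z^K_T=(z_1,\dots,z_k)$ then $(\vartheta,\det\mathscr Z^K_T)=\det(\theta_i(z_j))_{1\le i,j\le k}$. The dual spaces $E^*$ and $F^*$ are inner product spaces (antilinear in the first variable), and the dual basis $(e_i^\star)_{i\in S}$ of $E^*$ is orthogonal, with $\langle e_i^\star,e_j^\star\rangle=x_i\delta_{ij}$ for positive weights $\underline x=(x_i)_{i\in S}$; $\underline x^I=\prod_{i\in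 I}x_i$. $d:F^*\to E^*$ is the transpose of $\partial$ and $d^*$ is the adjoint of $d$. Set $E^*_T=\mathrm{Vect}(e_i^\star:i\in T)$. For $T\in\mathcal B(\mathcal M)$, $w(T)$ is the real number, independent of $\underline x$, such that $\det\big((dd^* )^{E^*_T}_{E^*_T}\big)=w(T)\,\underline x^T$, where $(dd^* )^{E^*_T}_{E^*_T}$ is the compression of $dd^*$ to $E^*_T$ (restriction to $E^*_T$ followed by orthogonal projection onto $E^*_T$). For $K\in\mathcal B_k(\mathcal M)$, $w(K)=w(T)\,|(\vartheta,\det\mathscr Z^K_T)|^2$ for any basis $T\subseteq K$ of $\mathcal M$ (this does not depend on the choice of $T$). Given a finite-dimensional inner product space with an orthonormal basis indexed by a finite set $S$ and a subspace $H$, a random subset $Y$ of $S$ is determinantal associated to $H$ in this basis if $\mathbb P(J\subseteq Y)=\det((\Pi^H)^J_J)$ for all $J\subseteq S$, where $\Pi^H$ is the orthogonal projection on $H$ and $(\Pi^H)^J_J$ is the submatrix of its matrix in the basis with rows and columns in $J$. *)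

(* Defs.v *)
From HB Require Import structures.
From mathcomp Require Import all_boot all_order all_algebra.
From mathcomp Require Import complex.
From mathcomp Require Import all_classical all_reals all_analysis.

Set Implicit Arguments.
Unset Strict Implicit.
Unset Printing Implicit Defensive.

Import Order.TTheory GRing.Theory Num.Theory.

Local Open Scope ring_scope.

(** ** The scalar field: the reals or the complex numbers *)

Inductive real_or_complex := RealScalars | ComplexScalars.

Definition scalars (R : realType) (c : real_or_complex) : numFieldType :=
  match c with
  | RealScalars => R
  | ComplexScalars => R[i]%C
  end.

Definition of_real (R : realType) (c : real_or_complex) : R -> scalars R c :=
  match c with
  | RealScalars => fun r => r
  | ComplexScalars => fun r => (r%:C)%C
  end.

Definition scalar_conj (R : realType) (c : real_or_complex) :
    {rmorphism scalars R c -> scalars R c} :=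
  match c with
  | RealScalars => idfun
  | ComplexScalars => @conjc R
  end.

(* [`|z|] itself lives in [scalars R c]; this is the real-valued modulus. *)
Definition modulus (R : realType) (c : real_or_complex) : scalars R c -> R :=
  match c with
  | RealScalars => fun z => `|z|
  | ComplexScalars => fun z => ComplexField.Normc.normc z
  end.

(** ** Linear algebra *)


Section Duality.
Variables (K : fieldType) (V W : vectType K).

Definition dual_basis (n : nat) (b : n.-tuple V) : n.-tuple 'Hom(V, K^o) :=
  [tuple linfun (coord b i : V -> K^o) | i < n].

Definition transpose (f : 'Hom(V, W)) : 'Hom('Hom(W, K^o), 'Hom(V, K^o)) :=
  linfun (fun phi : 'Hom(W, K^o) => (phi \o f)%VF).

Definition lfun_det (f : 'End(V)) : K :=
  \det (passmx.mxof (vbasis {:V}) (vbasis {:V}) f).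

Definition span_on (n : nat) (b : n.-tuple V) (I : {set 'I_n}) : {vspace V} :=
  <<[seq tnth b i | i <- enum I]>>%VS.

End Duality.

(* Inner products are the library's positive definite hermitian forms, which
   are linear in the first variable and antilinear in the second one: the
   inner product <u, v>, antilinear in u, is rendered as [ip v u]. *)
Section InnerProduct.
Variables (K : numFieldType) (theta : {rmorphism K -> K}).

(* <h w, v> = <w, g v> *)
Definition adjoint (V W : vectType K) (ipV : {dot V for theta})
    (ipW : {dot W for theta}) (g : 'Hom(V, W)) : 'Hom(W, V) :=
  xget 0 [set h : 'Hom(W, V) | forall v w, ipV v (h w) = ipW (g v) w]%classic.

Variables (V : vectType K) (ip : {dot V for theta}).

Definition orth_proj (H : {vspace V}) : 'End(V) := daddv_pi H (orthov ip H).

Definition compression (H : {vspace V}) (g : 'End(V)) : 'End(subvs_of H) :=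
  linfun (fun u : subvs_of H => vsproj H (orth_proj H (g (vsval u)))).

Definition orth_proj_mx (n : nat) (b : n.-tuple V) (H : {vspace V}) : 'M[K]_n :=
  \matrix_(i, j) coord b i (orth_proj H (tnth b j)).

End InnerProduct.

Definition principal_submx (K : Type) (n : nat) (J : {set 'I_n}) (M : 'M[K]_n) :
    'M[K]_#|J| :=
  \matrix_(i, j) M (enum_val i) (enum_val j).

(** ** The linear matroid *)

Section LinearMatroid.
Variables (K : fieldType) (E F : vectType K) (s : nat).
Variables (e : s.-tuple E) (del : 'Hom(E, F)).

Definition independent (I : {set 'I_s}) : bool :=
  free [seq del (tnth e i) | i <- enum I].

Definition matroid_basis (T : {set 'I_s}) : bool :=
  maxset independent T.

Definition matroid_bases_up (k : nat) : {set {set 'I_s}} :=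
  [set A : {set 'I_s} | (#|A| == \dim (limg del) + k)%N &
    [exists T : {set 'I_s}, matroid_basis T && (T \subset A)]].

(* Projection onto the kernel of [del], along the span of the e_i, i in T. *)
Definition kernel_proj (T : {set 'I_s}) : 'End(E) :=
  daddv_pi (lker del) (span_on e T).

(* [enum] lists ordinals in increasing order. *)
Definition kernel_basis (A T : {set 'I_s}) : seq E :=
  [seq kernel_proj T (tnth e j) | j <- enum (A :\: T)].

(* The pairing of th_1 /\ ... /\ th_k with z_1 /\ ... /\ z_k. *)
Definition wedge_pairing (k : nat) (th : k.-tuple 'Hom(E, K^o)) (z : seq E) : K :=
  \det (\matrix_(i < k, j < k) (tnth th i z`_j : K)).

End LinearMatroid.

(** ** Weights *)

Definition setprod (R : realType) (s : nat) (x : 'I_s -> R) (I : {set 'I_s}) : R :=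
  \prod_(i in I) x i.

Section Weights.
Variables (R : realType) (c : real_or_complex).
Local Notation K := (scalars R c).
Local Notation conj := (scalar_conj R c).
Variables (E F : vectType K) (s : nat) (e : s.-tuple E) (del : 'Hom(E, F)).

Definition weighted_dot (x : 'I_s -> R) (ipE : {dot 'Hom(E, K^o) for conj}) : Prop :=
  forall i j : 'I_s,
    ipE (tnth (dual_basis e) i) (tnth (dual_basis e) j)
      = if i == j then of_real c (x i) else 0.

Variable ipF : {dot 'Hom(F, K^o) for conj}.

(* The real number, independent of the weights [x], such that
   det (compression of d d^* to E^*_T) = w(T) x^T. *)
Definition basis_weight (T : {set 'I_s}) : R :=
  xget 0 [set r : R |
    forall (x : 'I_s -> R) (ipE : {dot 'Hom(E, K^o) for conj}),
      (forall i, 0 < x i) -> weighted_dot x ipE ->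
      let d := transpose del in
      lfun_det (compression ipE (span_on (dual_basis e) T)
                  (d \o adjoint ipF ipE d)%VF)
        = of_real c (r * setprod x T)]%classic.

Variables (k : nat) (th : k.-tuple 'Hom(E, K^o)).

(* Some basis contained in [A] is picked; the value does not depend on it. *)
Definition up_weight (A : {set 'I_s}) : R :=
  if [pick T | matroid_basis e del T && (T \subset A)] is Some T
  then basis_weight T * modulus (wedge_pairing th (kernel_basis e del A T)) ^+ 2
  else 0.

Definition partition_sum (x : 'I_s -> R) : R :=
  \sum_(A in matroid_bases_up e del k) up_weight A * setprod x A.

(* The basis e_i^* / sqrt x_i of the dual of E. *)
Definition normalized_dual_basis (x : 'I_s -> R) : s.-tuple 'Hom(E, K^o) :=
  [tuple (of_real c (Num.sqrt (x i)))^-1 *: tnth (dual_basis e) i | i < s].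

End Weights.

(** ** Determinantal random subsets *)

Section Determinantal.
Variables (R : realType) (c : real_or_complex).
Local Notation K := (scalars R c).
Local Notation conj := (scalar_conj R c).
Variables (disp : measure_display) (Omega : measurableType disp).
Variables (P : probability Omega R) (s : nat) (Y : Omega -> {set 'I_s}).

Definition random_subset : Prop :=
  forall A : set {set 'I_s}, measurable (Y @^-1` A)%classic.

(* [b] is meant to be orthonormal for [ip]. *)
Definition determinantal (V : vectType K) (ip : {dot V for conj})
    (b : s.-tuple V) (H : {vspace V}) : Prop :=
  random_subset /\
  forall J : {set 'I_s},
    of_real c (fine (P [set w | J \subset Y w]%classic))
      = \det (principal_submx J (orth_proj_mx ip b H)).

End Determinantal.

(* Main.v *)
(**
Let r = rank d + k = dim H, and let mu be the basis of H made of a basis of im d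
followed by theta_1, ..., theta_k.  In an orthonormal basis the orthogonal
projection on H has matrix (up to transposition) N^* G^-1 N, where the rows of N
are the coordinates of mu and G = N N^* is its Gram matrix.  Hence its principal
minors of size > r vanish, so |Y| <= r almost surely, while its trace r is the
expectation of |Y|; thus |Y| = r almost surely, and for |A| = r the event that A
is contained in Y is Y = A, so that P(Y = A) = |det N_A|^2 / det G.  In particular
neither inclusion-exclusion nor the Cauchy-Binet formula is needed.

On the other side, the compression of d d^* to E^*_T has determinant
gamma |det C_T|^2 x^T, where the rows of C are the chosen basis of im d and gamma
is a Gram determinant depending only on the inner product of F^*; and
det M_A = +- det C_T (vartheta, det Z^A_T), where M = N diag(x)^(-1/2).  So
P(Y = A) is proportional to w(A) x^A, with a constant fixed by total mass 1.
*)
Require Import Defs.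
From HB Require Import structures.
From mathcomp Require Import all_boot all_order all_algebra.
From mathcomp Require Import complex.
From mathcomp Require Import all_classical all_reals all_analysis.
From mathcomp Require Import perm.

Set Implicit Arguments.
Unset Strict Implicit.
Unset Printing Implicit Defensive.

Import Order.TTheory GRing.Theory Num.Theory.

Local Open Scope ring_scope.

(** * Inner products and orthogonal projections *)

Section Gram.
Variables (K : numFieldType) (theta : {rmorphism K -> K}).
Variables (V : vectType K) (ip : {dot V for theta}).

Lemma dotC u v : ip u v = theta (ip v u).
Proof. by rewrite hermC expr0 mul1r. Qed.

Lemma dot_eq0 u : ip u u = 0 -> u = 0.
Proof. by apply: contra_eq => /(neq0_dnorm_gt0 (s := ip)) /lt0r_neq0. Qed.

Lemma dot_suml I (r : seq I) (P : pred I) (f : I -> V) v :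
  ip (\sum_(i <- r | P i) f i) v = \sum_(i <- r | P i) ip (f i) v.
Proof. exact: linear_sumlz. Qed.

Lemma dot_sumr I (r : seq I) (P : pred I) (f : I -> V) v :
  ip v (\sum_(i <- r | P i) f i) = \sum_(i <- r | P i) ip v (f i).
Proof. exact: linear_sumr. Qed.

Lemma dotZl a u v : ip (a *: u) v = a * ip u v.
Proof. exact: linearZl_LR. Qed.

Lemma dotZr a u v : ip u (a *: v) = theta a * ip u v.
Proof. exact: linearZr_LR. Qed.

Lemma dotBl u v w : ip (u - v) w = ip u w - ip v w.
Proof. exact: linearBl. Qed.

Lemma dot0r u : ip u 0 = 0.
Proof. exact: linear0r. Qed.

Lemma dotBr u v w : ip u (v - w) = ip u v - ip u w.
Proof. exact: linearBr. Qed.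

Definition gram_mx n (v : n.-tuple V) : 'M[K]_n :=
  \matrix_(i, j) ip (tnth v i) (tnth v j).

(** A vector [u] of the left kernel gives a combination [w] of the [v_i] orthogonal to every [v_j],
    hence to itself; definiteness makes [w] zero, and freeness then makes [u] zero. *)
Lemma gram_unitmx n (v : n.-tuple V) : free v -> gram_mx v \in unitmx.
Proof.
move=> v_free; rewrite -row_free_unit -kermx_eq0; apply/eqP/row_matrixP => l.
rewrite row0; set u := row l _.
have /sub_kermxP uG : (u <= kermx (gram_mx v))%MS by rewrite row_sub.
pose w := \sum_i u 0 i *: v`_i.
have w_perp j : ip w (tnth v j) = 0.
  have := congr1 (fun A : 'rV_n => A 0 j) uG; rewrite !mxE => <-.
  rewrite /w dot_suml; apply: eq_bigr => i _.
  by rewrite dotZl [gram_mx _ _ _]mxE -tnth_nth.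
have w0 : w = 0.
  apply: dot_eq0; rewrite {2}/w dot_sumr big1 // => i _.
  by rewrite dotZr -tnth_nth w_perp mulr0.
apply/rowP => i; rewrite [RHS]mxE.
exact: (freeP v_free (fun i => u 0 i) w0 i).
Qed.

(** The Gram matrix is hermitian; this is what makes Gram determinants real constants below. *)
Lemma det_gram_conj n (v : n.-tuple V) :
  theta (\det (gram_mx v)) = \det (gram_mx v).
Proof.
rewrite -det_map_mx -det_tr; congr (\det _); apply/matrixP => i j.
by rewrite !mxE -dotC.
Qed.

(** Riesz representation, by solving a linear system with the Gram matrix of a basis. The solution
    is conjugated because [ip] is antilinear in its second argument; the sigma type lets the vector
    enter definitions. *)
Lemma riesz_vector (l : 'Hom(V, K^o)) : involutive theta ->
  {w : V | forall v, ip v w = l v}.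
Proof.
move=> thetaK; pose b := vbasis {:V}.
have bG := gram_unitmx (basis_free (vbasisP {:V})).
pose om : 'cV[K]_(\dim {:V}) := invmx (gram_mx b) *m \col_i (l (tnth b i) : K).
exists (\sum_j theta (om j 0) *: tnth b j) => v.
have ipb i : ip (tnth b i) (\sum_j theta (om j 0) *: tnth b j) = l (tnth b i).
  have := mulKVmx bG (\col_i (l (tnth b i) : K)).
  move/(congr1 (fun A : 'cV_ _ => A i 0)); rewrite [RHS]mxE => <-.
  rewrite dot_sumr mxE; apply: eq_bigr => j _.
  by rewrite dotZr thetaK [gram_mx _ _ _]mxE mulrC.
rewrite (coord_vbasis (memvf v)) dot_suml linear_sum.
apply: eq_bigr => i _; rewrite dotZl linearZ /=.
by rewrite -(tnth_nth 0) ipb.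
Qed.

Lemma orth_projE (H : {vspace V}) u h :
  h \in H -> (forall v, v \in H -> ip (u - h) v = 0) -> orth_proj ip H u = h.
Proof.
move=> hH perp; rewrite /orth_proj.
have HI : (H :&: orthov ip H = 0)%VS.
  apply/eqP; rewrite -subv0; apply/subvP => v /memv_capP[vH /mem_orthovP vo].
  by rewrite memv0; apply/eqP/dot_eq0/vo.
have HI' : (orthov ip H :&: H = 0)%VS by rewrite capvC.
have uhO : u - h \in orthov ip H by apply/mem_orthovP.
have -> : u = h + (u - h) by rewrite addrC subrK.
rewrite linearD /= daddv_pi_id //.
(* The two projections of [u - h] add up to it, and the one on the orthogonal of [H] already fixes
   it, so the one on [H] vanishes. *)
have := daddv_pi_add HI (subvP (addvSr _ _) _ uhO).
by rewrite (daddv_pi_id HI' uhO) => /(canRL (addrK _)) ->; rewrite subrr addr0.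
Qed.

(** The coefficients are the row of products with [m] times the inverse Gram matrix. Multiplying by
    the Gram matrix gives these products back, so the remainder is orthogonal to [m]. *)
Lemma orth_proj_basis (H : {vspace V}) n (m : n.-tuple V) u :
    basis_of H m ->
  orth_proj ip H u =
    \sum_a (\sum_b ip u (tnth m b) * invmx (gram_mx m) b a) *: tnth m a.
Proof.
move=> mH; have mG := gram_unitmx (basis_free mH); apply: orth_projE.
  apply: rpred_sum => a _; apply: rpredZ.
  by apply: (basis_mem mH); apply: mem_tnth.
have perp c : ip (u - \sum_a (\sum_b ip u (tnth m b) * invmx (gram_mx m) b a)
    *: tnth m a) (tnth m c) = 0.
  rewrite dotBl dot_suml; apply/eqP; rewrite subr_eq0; apply/eqP.
  transitivity ((\row_b ip u (tnth m b) *m invmx (gram_mx m) *m gram_mx m) 0 c).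
    by rewrite mulmxKV // mxE.
  rewrite mxE; apply: eq_bigr => a _; rewrite dotZl !mxE; congr (_ * _).
  by apply: eq_bigr => b _; rewrite mxE.
move=> v vH; rewrite (coord_basis mH vH) dot_sumr big1 // => c _.
by rewrite dotZr -tnth_nth perp mulr0.
Qed.

Lemma coord_orthonormal n (b : n.-tuple V) v i :
    basis_of {:V} b ->
    (forall i j, ip (tnth b i) (tnth b j) = (i == j)%:R) ->
  coord b i v = ip v (tnth b i).
Proof.
move=> bV bE; rewrite {2}(coord_basis bV (memvf v)) dot_suml.
rewrite (bigD1 i) //= dotZl -tnth_nth bE eqxx mulr1 big1 ?addr0 //.
by move=> j /negPf ji; rewrite dotZl -tnth_nth bE ji mulr0.
Qed.

(** The transpose arises because [N] stores coordinates in rows; it changes neither principal minors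
    nor the trace. The second identity serves for the trace. *)
Lemma orth_proj_mxE (H : {vspace V}) n (m : n.-tuple V) s (b : s.-tuple V)
    (N := \matrix_(a < n, i < s) coord b i (tnth m a)) :
    basis_of H m -> basis_of {:V} b ->
    (forall i j, ip (tnth b i) (tnth b j) = (i == j)%:R) ->
  (orth_proj_mx ip b H)^T =
    (map_mx theta N)^T *m invmx (gram_mx m) *m N /\
  gram_mx m = N *m (map_mx theta N)^T.
Proof.
move=> mH bV bE; split.
  apply/matrixP => i j; rewrite !mxE (orth_proj_basis _ mH) linear_sum.
  apply: eq_bigr => a _; rewrite linearZ /= !mxE; congr (_ * _).
  apply: eq_bigr => c _; rewrite !mxE; congr (_ * _).
  by rewrite dotC (coord_orthonormal _ _ bV bE).
apply/matrixP => a c; rewrite !mxE {1}(coord_basis bV (memvf (tnth m a))).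
rewrite dot_suml; apply: eq_bigr => i _.
by rewrite dotZl -tnth_nth !mxE !(coord_orthonormal _ _ bV bE) -dotC.
Qed.

End Gram.

(** The matrices of change of basis between [b] and [vbasis] are mutually inverse, so their
    determinants cancel. *)
Lemma lfun_det_basis (K : fieldType) (V : vectType K) n (b : n.-tuple V)
    (f : 'End(V)) :
  basis_of {:V} b -> lfun_det f = \det (\matrix_(i, j) coord b j (f (tnth b i))).
Proof.
move=> bV; have En : n = \dim {:V} by rewrite (size_basis bV).
subst n.
set b' := vbasis {:V}; have b'V : basis_of {:V} b' := vbasisP _.
have -> : \matrix_(i, j) coord b j (f (tnth b i)) = passmx.mxof b b f.
  by apply/matrixP => i j; rewrite !mxE passmx.vecof_delta -tnth_nth.
have Ef : passmx.mxof b b f = passmx.mxof b b' \1%VF *m passmx.mxof b' b' f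
    *m passmx.mxof b' b \1%VF.
  by rewrite -!passmx.mxof_comp // comp_lfun1r comp_lfun1l.
have E1 : passmx.mxof b b' \1%VF *m passmx.mxof b' b \1%VF = 1%:M.
  by rewrite -passmx.mxof_comp // comp_lfun1l passmx.mxof1 // (basis_free bV).
rewrite Ef !det_mulmx mulrAC -det_mulmx E1 det1 mul1r //.
Qed.

(** * Minors *)

Section MatrixMinors.

(** The increasing enumeration of [A], cast so that the columns indexed by [A] of a matrix with r
    rows form a square matrix. *)
Definition enum_cast s r (A : {set 'I_s}) (hA : #|A| = r) (i : 'I_r) : 'I_s :=
  enum_val (cast_ord (esym hA) i).

Lemma enum_cast_inj s r (A : {set 'I_s}) (hA : #|A| = r) :
  injective (enum_cast hA).
Proof. by move=> i j /enum_val_inj /cast_ord_inj. Qed.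

Lemma enum_castP s r (A : {set 'I_s}) (hA : #|A| = r) i :
  enum_cast hA i \in A.
Proof. exact: enum_valP. Qed.

Lemma enum_cast_surj s r (A : {set 'I_s}) (hA : #|A| = r) i :
  i \in A -> exists j, i = enum_cast hA j.
Proof.
move=> iA; exists (cast_ord hA (enum_rank_in iA i)).
by rewrite /enum_cast cast_ordK enum_rankK_in.
Qed.

(** [f] is [g] after a permutation. Knowing that some sign exists suffices, since minors are later
    multiplied by their conjugates. *)
Lemma det_colsub_reorder (R : comNzRingType) r s (M : 'M[R]_(r, s))
    (f g : 'I_r -> 'I_s) : injective f -> (forall i, exists j, f i = g j) ->
  exists b : bool, \det (colsub f M) = (-1) ^+ b * \det (colsub g M).
Proof.
move=> f_inj fg; have fg' i : exists j, f i == g j.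
  by have [j ->] := fg i; exists j.
pose h i := xchoose (fg' i); have fE i : f i = g (h i).
  exact/eqP/(xchooseP (fg' i)).
have h_inj : injective h by move=> i j hij; apply: f_inj; rewrite !fE hij.
exists (perm h_inj : bool).
have -> : colsub f M = col_perm (perm h_inj) (colsub g M).
  by apply/matrixP => i j; rewrite !mxE permE fE.
by rewrite col_permE det_mulmx det_perm odd_permV mulrC.
Qed.

(** Once restricted to the indices in [A], all three factors are square because [#|A| = r], so the
    determinant is multiplicative. *)
Lemma det_principal_sandwich (K : fieldType) (theta : {rmorphism K -> K}) r s
    (N : 'M[K]_(r, s)) (G : 'M[K]_r) (A : {set 'I_s}) (hA : #|A| = r) :
  \det (principal_submx A ((map_mx theta N)^T *m G *m N)) =
    \det G * (\det (colsub (enum_cast hA) N)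
               * theta (\det (colsub (enum_cast hA) N))).
Proof.
subst r; have -> : principal_submx A ((map_mx theta N)^T *m G *m N)
    = (map_mx theta (colsub (enum_cast erefl) N))^T *m G
      *m colsub (enum_cast erefl) N.
  apply/matrixP => i j; rewrite !mxE; apply: eq_bigr => a _.
  rewrite !mxE /enum_cast !cast_ord_id; congr (_ * _).
  by apply: eq_bigr => b _; rewrite !mxE /enum_cast cast_ord_id.
by rewrite !det_mulmx det_tr det_map_mx [theta _ * \det G]mulrC -mulrA
  [theta _ * _]mulrC.
Qed.

(** The submatrix factors through dimension [r], so its rank is too small for it to be
    invertible. *)
Lemma det_principal_mulmx0 (K : fieldType) r s (P : 'M[K]_(s, r))
    (N : 'M[K]_(r, s)) (A : {set 'I_s}) :
  (r < #|A|)%N -> \det (principal_submx A (P *m N)) = 0.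
Proof.
move=> rA; have -> : principal_submx A (P *m N) =
    rowsub (@enum_val _ (mem A)) P *m colsub (@enum_val _ (mem A)) N.
  by apply/matrixP => i j; rewrite !mxE; apply: eq_bigr => a _; rewrite !mxE.
apply: contraTeq rA; rewrite -unitfE -unitmxE -leqNgt => /mxrank_unit {1}<-.
exact: mulmx_max_rank.
Qed.

Lemma det_principal1 (R : comNzRingType) s (M : 'M[R]_s) i :
  \det (principal_submx [set i] M) = M i i.
Proof.
have val_i (k : 'I_#|[set i]|) : enum_val k = i.
  by apply/set1P; exact: enum_valP.
have -> : principal_submx [set i] M = const_mx (M i i).
  by apply/matrixP => k l; rewrite !mxE !val_i.
by rewrite cards1 det_mx11 mxE.
Qed.

Lemma det_tr_principal (R : comNzRingType) s (M : 'M[R]_s) A :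
  \det (principal_submx A M^T) = \det (principal_submx A M).
Proof.
by rewrite -det_tr; congr (\det _); apply/matrixP => i j; rewrite !mxE.
Qed.

End MatrixMinors.

(** * Bases of the matroid *)

Section MatroidBases.
Variables (K : fieldType) (E F : vectType K) (s : nat).
Variables (e : s.-tuple E) (del : 'Hom(E, F)).
Hypothesis he : basis_of {:E} e.

Local Notation imgs I := [seq del (tnth e i) | i <- enum (I : {set 'I_s})].

Lemma independentU1 (I : {set 'I_s}) i : i \notin I ->
  independent e del (i |: I) =
    (del (tnth e i) \notin <<imgs I>>%VS) && independent e del I.
Proof.
move=> iI; rewrite /independent -free_cons.
have /(perm_map (fun j => del (tnth e j))) : perm_eq (enum (i |: I)) (i :: enum I).
  apply: uniq_perm; rewrite /= ?mem_enum ?iI ?enum_uniq // => j.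
  by rewrite mem_enum !inE mem_enum.
exact: perm_free.
Qed.

Lemma span_imgs_sub (I : {set 'I_s}) : (<<imgs I>> <= limg del)%VS.
Proof. by apply/span_subvP => _ /mapP[i _ ->]; apply: memv_img (memvf _). Qed.

Lemma span_imgs_full (I : {set 'I_s}) :
  (forall i, del (tnth e i) \in <<imgs I>>%VS) -> <<imgs I>>%VS = limg del.
Proof.
move=> sub; apply/eqP; rewrite eqEsubv span_imgs_sub /=.
rewrite -(span_basis he) limg_span; apply/span_subvP => _ /mapP[_ /tnthP[i ->] ->].
exact: sub.
Qed.

(** An [i] whose image lay outside the span could be added to [T], against maximality. *)
Lemma matroid_basis_of T : matroid_basis e del T -> basis_of (limg del) (imgs T).
Proof.
move=> /maxsetP[T_ind T_max]; apply/andP; split=> //.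
apply/eqP/span_imgs_full => i; have [iT | iT] := boolP (i \in T).
  by apply: memv_span; apply/mapP; exists i; rewrite ?mem_enum.
apply: contraNT (iT) => i_notin.
have iT_ind : independent e del (i |: T) by rewrite independentU1 // i_notin.
by rewrite -(T_max _ iT_ind (finset.subsetUr _ _)) finset.setU11.
Qed.

Lemma card_matroid_basis T : matroid_basis e del T -> #|T| = \dim (limg del).
Proof.
move=> /matroid_basis_of TB; have := basis_free TB.
by rewrite /free (span_basis TB) size_map -cardE => /eqP.
Qed.

(** Take [T] maximal among the independent subsets of [A]. It spans the whole image, so by dimension
    no independent set of any kind is larger, and [T] is maximal outright. *)
Lemma matroid_basis_within (A : {set 'I_s}) : <<imgs A>>%VS = limg del ->
  exists2 T : {set 'I_s}, matroid_basis e del T & T \subset A.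
Proof.
move=> A_full; pose P := [pred I : {set 'I_s} | independent e del I & I \subset A].
have P0 : P finset.set0 by rewrite /= /independent enum_set0 nil_free finset.sub0set.
have [T /maxsetP[/andP[T_ind TA] T_max] _] := maxset_exists P0.
have T_full : <<imgs T>>%VS = limg del.
  apply/eqP; rewrite eqEsubv span_imgs_sub /= -A_full.
  apply/span_subvP => _ /mapP[i iA ->]; rewrite mem_enum in iA.
  have [iT | iT] := boolP (i \in T).
    by apply: memv_span; apply/mapP; exists i; rewrite ?mem_enum.
  apply: contraNT (iT) => i_notin.
  have iT_P : P (i |: T).
    by rewrite /= independentU1 // i_notin T_ind finset.subUset finset.sub1set iA.
  by rewrite -(T_max _ iT_P (finset.subsetUr _ _)) finset.setU11.
exists T => //; apply/maxsetP; split=> // I I_ind TI.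
apply/eqP; rewrite eq_sym finset.eqEcard TI /=.
rewrite cardE [in leqRHS]cardE -(size_map (fun i => del (tnth e i)) (enum I)).
rewrite -(size_map (fun i => del (tnth e i)) (enum T)).
rewrite -(eqP T_ind) T_full -(eqP I_ind); exact: dimvS (span_imgs_sub I).
Qed.

(** [del] maps the span of the [e_i], i in T, onto its image, whose dimension is [#|T|];
    rank-nullity on that span makes the intersection zero, and a dimension count gives the sum. *)
Lemma kernel_complement T : matroid_basis e del T ->
  (lker del :&: span_on e T = 0)%VS /\ (lker del + span_on e T = fullv)%VS.
Proof.
move=> TB; have imT : (del @: span_on e T)%VS = limg del.
  rewrite /span_on limg_span -map_comp; exact: span_basis (matroid_basis_of TB).
have dT : (\dim (span_on e T) <= \dim (limg del))%N.
  rewrite -(card_matroid_basis TB) cardE -(size_map (tnth e)); exact: dim_span.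
have := limg_ker_dim del (span_on e T); rewrite imT => dk.
have k0 : \dim (span_on e T :&: lker del) = 0%N.
  by apply/eqP; rewrite -leqn0 -(leq_add2r (\dim (limg del))) dk.
have cap0 : (lker del :&: span_on e T = 0)%VS.
  by apply/eqP; rewrite capvC -dimv_eq0 k0.
split=> //; apply/eqP; rewrite eqEdim subvf /= dimv_disjoint_sum //.
by rewrite -dk k0 add0n -(limg_ker_dim del fullv) capfv.
Qed.

Lemma coord_span_on (T : {set 'I_s}) v i :
  v \in span_on e T -> i \notin T -> coord e i v = 0.
Proof.
move=> vT iT; have : (span_on e T <= lker (linfun (coord e i : E -> K^o)))%VS.
  apply/span_subvP => _ /mapP[j jT ->]; rewrite memv_ker lfunE /=.
  rewrite (tnth_nth 0) coord_free ?(basis_free he) //.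
  by case: (j =P i) jT iT => [-> | _ _ _ /=]; rewrite ?mem_enum ?eqxx // => ->.
by move/subvP/(_ _ vT); rewrite memv_ker lfunE => /eqP.
Qed.

Lemma kernel_projE T j : matroid_basis e del T ->
  tnth e j = kernel_proj e del T (tnth e j)
    + \sum_(i in T) coord e i (tnth e j - kernel_proj e del T (tnth e j))
        *: tnth e i.
Proof.
move=> TB; have [cap0 add1] := kernel_complement TB.
set z := kernel_proj _ _ _ _; set v := _ - z.
suff vT : v \in span_on e T.
  suff <- : v = \sum_(i in T) coord e i v *: tnth e i by rewrite addrC subrK.
  rewrite {1}(coord_basis he (memvf v)) [RHS]big_mkcond /=.
  apply: eq_bigr => i _; rewrite -tnth_nth; case: ifPn => // iT.
  by rewrite (coord_span_on vT iT) scale0r.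
have : tnth e j \in (lker del + span_on e T)%VS by rewrite add1 memvf.
move/(daddv_pi_add cap0) => jE; rewrite /v -{1}jE addrAC subrr add0r.
exact: memv_pi.
Qed.

Lemma kernel_proj_ker T v : del (kernel_proj e del T v) = 0.
Proof. by apply/eqP; rewrite -memv_ker; apply: memv_pi. Qed.

End MatroidBases.

(** * Scalars and linear maps *)

Section Scalars.
Variables (R : realType) (c : real_or_complex).

Lemma of_real_is_zmod_morphism : zmod_morphism (of_real c : R -> scalars R c).
Proof. by case: c => a b //=; rewrite rmorphB. Qed.

Lemma of_real_is_monoid_morphism : monoid_morphism (of_real c : R -> scalars R c).
Proof. by case: c; split=> //= a b; rewrite rmorphM. Qed.

HB.instance Definition _ :=
  GRing.isZmodMorphism.Build R (scalars R c) (of_real c) of_real_is_zmod_morphism.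
HB.instance Definition _ :=
  GRing.isMonoidMorphism.Build R (scalars R c) (of_real c)
    of_real_is_monoid_morphism.

Lemma of_realM (a b : R) : of_real c (a * b) = of_real c a * of_real c b.
Proof. exact: rmorphM. Qed.

Lemma of_real_neq0 (a : R) : (of_real c a != 0) = (a != 0).
Proof. by rewrite fmorph_eq0. Qed.

Lemma of_real_inj : injective (of_real c : R -> scalars R c).
Proof. exact: fmorph_inj. Qed.

Lemma scalar_conjK : involutive (scalar_conj R c).
Proof. by case: c => z //=; rewrite conjcK. Qed.

Lemma scalar_conj_real r : scalar_conj R c (of_real c r) = of_real c r.
Proof. by case: c => //=; exact: conjc_real. Qed.

(** Turns Gram determinants, which live in the scalar field, into real constants. *)
Lemma scalar_conj_fix z : scalar_conj R c z = z -> exists r, z = of_real c r.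
Proof.
case: c z => [z _|[a b] /= [/eqP]]; first by exists z.
by rewrite eq_sym -addr_eq0 -mulr2n mulrn_eq0 /= => /eqP ->; exists a.
Qed.

Lemma modulus_sqr (z : scalars R c) :
  of_real c (modulus z ^+ 2) = z * scalar_conj R c z.
Proof.
case: c z => [z|[a b]] /=; first by rewrite real_normK ?num_real ?expr2.
rewrite sqr_sqrtr ?addr_ge0 ?sqr_ge0 //; apply/eqP.
by rewrite eq_complex /= !mulrN opprK -!expr2 eqxx /= [b * a]mulrC addNr.
Qed.

End Scalars.

(** * Transposes and a basis of the image of d *)

Section CompositionMaps.
Variable K : fieldType.

(** The body of [transpose] as a named function, so that it can carry a linear structure and [lfunE]
    applies. *)
Definition precomp_lfun (V W : vectType K) (f : 'Hom(V, W))
    (phi : 'Hom(W, K^o)) : 'Hom(V, K^o) := (phi \o f)%VF.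

Lemma precomp_lfun_is_linear (V W : vectType K) (f : 'Hom(V, W)) :
  linear (precomp_lfun f).
Proof. by move=> a u v; rewrite /precomp_lfun comp_lfunDl comp_lfunZl. Qed.

HB.instance Definition _ (V W : vectType K) (f : 'Hom(V, W)) :=
  GRing.isLinear.Build K _ _ *:%R (precomp_lfun f) (precomp_lfun_is_linear f).

Lemma transposeE (V W : vectType K) (f : 'Hom(V, W)) phi v :
  transpose f phi v = phi (f v).
Proof.
have -> : transpose f phi = precomp_lfun f phi by exact: (lfunE (precomp_lfun f)).
by rewrite comp_lfunE.
Qed.

Variables (V W : vectType K) (del : 'Hom(V, W)).
Let n := \dim (limg del).

Definition image_functionals : n.-tuple 'Hom(V, K^o) :=
  [tuple transpose del (linfun (coord (vbasis (limg del)) a : W -> K^o)) | a < n].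

Lemma image_functionalsE a v :
  tnth image_functionals a v = coord (vbasis (limg del)) a (del v).
Proof. by rewrite tnth_mktuple transposeE lfunE. Qed.

(** A pulled back form depends only on its values on [limg del], which gives spanning; evaluation at
    preimages of the basis vectors gives freeness. Hence d and [del] have the same rank. *)
Lemma image_functionals_basis : basis_of (limg (transpose del)) image_functionals.
Proof.
have bfree := basis_free (vbasisP (limg del)).
rewrite /basis_of; apply/andP; split.
  rewrite eqEsubv; apply/andP; split.
    by apply/span_subvP => _ /tnthP[a ->]; rewrite tnth_mktuple memv_img ?memvf.
  apply/subvP => _ /memv_imgP[phi _ ->].
  have -> : transpose del phi =
      \sum_a (phi (tnth (vbasis (limg del)) a) : K) *: tnth image_functionals a.
    apply/lfunP => v; rewrite transposeE sum_lfunE.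
    rewrite (coord_vbasis (memv_img del (memvf v))) linear_sum.
    apply: eq_bigr => a _; rewrite linearZ scale_lfunE image_functionalsE /=.
    by rewrite -tnth_nth; apply: mulrC.
  by apply: rpred_sum => a _; rewrite rpredZ ?memv_span ?mem_tnth.
apply/freeP => k sum0 b.
have /memv_imgP[v _ vb] : (vbasis (limg del))`_b \in limg del.
  by rewrite vbasis_mem // mem_nth // size_tuple.
have <- : (\sum_a k a *: image_functionals`_a) v = 0 by rewrite sum0 lfunE.
rewrite sum_lfunE (bigD1 b) // big1 ?addr0.
  rewrite scale_lfunE -tnth_nth image_functionalsE -vb coord_free // eqxx.
  by symmetry; apply: etrans (addr0 _) _; apply: mulr1.
move=> a /negPf ab; rewrite scale_lfunE -tnth_nth image_functionalsE -vb.
by rewrite coord_free // eq_sym ab; apply: mulr0.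
Qed.

End CompositionMaps.

(** The matrix C of the overview: its rows are the coordinates of [image_functionals] in the dual
    basis. *)
Definition image_mx (K : fieldType) (E F : vectType K) (s : nat) (e : s.-tuple E)
    (del : 'Hom(E, F)) : 'M[K]_(\dim (limg del), s) :=
  \matrix_(a, i) coord (vbasis (limg del)) a (del (tnth e i)).

Section Compression.
Variables (K : numFieldType) (theta : {rmorphism K -> K}).
Variables (V : vectType K) (ip : {dot V for theta}) (H : {vspace V}) (g : 'End(V)).

Definition compression_fun (u : subvs_of H) : subvs_of H :=
  vsproj H (orth_proj ip H (g (vsval u))).

Lemma compression_fun_is_linear : linear compression_fun.
Proof. by move=> a u v; rewrite /compression_fun !linearP. Qed.

HB.instance Definition _ :=
  GRing.isLinear.Build K _ _ *:%R compression_fun compression_fun_is_linear.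

Lemma compressionE u :
  compression ip H g u = vsproj H (orth_proj ip H (g (vsval u))).
Proof. exact: (lfunE compression_fun). Qed.

End Compression.

(** * The dual basis *)

Section DualBasis.
Variables (K : fieldType) (E : vectType K) (s : nat) (e : s.-tuple E).
Hypothesis he : basis_of {:E} e.

Lemma dual_basisE i v : tnth (dual_basis e) i v = coord e i v.
Proof. by rewrite tnth_mktuple lfunE. Qed.

Lemma dual_basis_tnth i j : tnth (dual_basis e) i (tnth e j) = (j == i)%:R.
Proof. by rewrite dual_basisE (tnth_nth 0) coord_free ?(basis_free he). Qed.

Lemma dual_basis_sum (w : 'Hom(E, K^o)) :
  w = \sum_i (w (tnth e i) : K) *: tnth (dual_basis e) i.
Proof.
apply/lfunP => v; rewrite {1}(coord_basis he (memvf v)) linear_sum sum_lfunE.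
apply: eq_bigr => i _; rewrite linearZ scale_lfunE dual_basisE -tnth_nth.
exact: mulrC.
Qed.

Lemma dual_basis_free : free (dual_basis e).
Proof.
apply/freeP => k sum0 j.
have <- : (\sum_i k i *: (dual_basis e)`_i) (tnth e j) = 0 by rewrite sum0 lfunE.
rewrite sum_lfunE (bigD1 j) // big1.
  rewrite scale_lfunE -tnth_nth dual_basis_tnth eqxx.
  by symmetry; apply: etrans (addr0 _) _; apply: mulr1.
move=> i /negPf ij; rewrite scale_lfunE -tnth_nth dual_basis_tnth eq_sym ij.
exact: mulr0.
Qed.

Lemma dual_basis_basis : basis_of {:'Hom(E, K^o)} (dual_basis e).
Proof.
rewrite /basis_of dual_basis_free andbT eqEsubv subvf; apply/subvP => w _.
rewrite (dual_basis_sum w); apply: rpred_sum => i _.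
by rewrite rpredZ ?memv_span ?mem_tnth.
Qed.

Definition eval_at (y : E) (phi : 'Hom(E, K^o)) : K^o := phi y.

Lemma eval_at_is_linear y : linear (eval_at y).
Proof. by move=> a u v; rewrite /eval_at add_lfunE scale_lfunE. Qed.

HB.instance Definition _ y :=
  GRing.isLinear.Build K _ _ *:%R (eval_at y) (eval_at_is_linear y).

Variable (T : {set 'I_s}).

Definition dual_span_tuple : #|T|.-tuple (subvs_of (span_on (dual_basis e) T)) :=
  [tuple vsproj _ (tnth (dual_basis e) (enum_val t)) | t < #|T|].

Lemma mem_dual_span i : i \in T -> tnth (dual_basis e) i \in span_on (dual_basis e) T.
Proof. by move=> iT; apply: memv_span; apply/mapP; exists i; rewrite ?mem_enum. Qed.

Lemma vsval_dual_span t :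
  vsval (tnth dual_span_tuple t) = tnth (dual_basis e) (enum_val t).
Proof. by rewrite tnth_mktuple vsprojK // mem_dual_span // enum_valP. Qed.

Lemma dual_span_tuple_basis :
  basis_of {:subvs_of (span_on (dual_basis e) T)} dual_span_tuple.
Proof.
rewrite basisEfree subvf; apply/and3P; split=> //; last first.
  rewrite dimvf size_tuple; apply: (leq_trans (dim_span _)).
  by rewrite size_map -cardE.
apply/freeP => k sum0 t.
have /(congr1 (fun f : 'Hom(E, K^o) => f (tnth e (enum_val t)))) :
    \sum_t k t *: tnth (dual_basis e) (enum_val t) = 0.
  rewrite -[RHS](linear0 (@vsval _ _ (span_on (dual_basis e) T))) -sum0 linear_sum.
  by apply: eq_bigr => t' _; rewrite -tnth_nth -vsval_dual_span -linearZ.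
rewrite lfunE sum_lfunE (bigD1 t) // big1.
  rewrite scale_lfunE dual_basis_tnth eqxx => kt; rewrite -[RHS]kt.
  by symmetry; apply: etrans (addr0 _) _; apply: mulr1.
move=> t' /negPf tt'; rewrite scale_lfunE dual_basis_tnth (inj_eq enum_val_inj).
by rewrite eq_sym tt'; apply: mulr0.
Qed.

End DualBasis.

(** * Weights of bases *)

Section BasisWeights.
Variables (R : realType) (c : real_or_complex).
Local Notation K := (scalars R c).
Local Notation conj := (scalar_conj R c).
Variables (E F : vectType K) (s : nat) (e : s.-tuple E) (del : 'Hom(E, F)).
Hypothesis he : basis_of {:E} e.
Variable ipF : {dot 'Hom(F, K^o) for conj}.

Local Notation n := (\dim (limg del)).
Local Notation beta := (vbasis (limg del)).

Local Notation C := (image_mx e del).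

Definition image_riesz : n.-tuple 'Hom(F, K^o) :=
  [tuple sval (riesz_vector ipF (linfun (eval_at (tnth beta a))) (@scalar_conjK R c))
    | a < n].

Lemma image_rieszE a v : ipF v (tnth image_riesz a) = v (tnth beta a).
Proof. by rewrite tnth_mktuple (svalP (riesz_vector _ _ _)) lfunE. Qed.

(** By antilinearity, a relation between the Riesz vectors with coefficients [k a] yields a vector
    with coefficients [conj (k a)] on which every form vanishes, so it is zero. *)
Lemma image_riesz_free : free image_riesz.
Proof.
apply/freeP => k sum0 b.
suff : \sum_a conj (k a) *: beta`_a = 0.
  move/(freeP (basis_free (vbasisP _)) (fun a => conj (k a)))/(_ b) => kb.
  by rewrite -[k b](@scalar_conjK R c) kb rmorph0.
set y := \sum_a _.
have y0 : forall v : 'Hom(F, K^o), v y = 0.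
  move=> v; rewrite -(dot0r ipF v) -sum0 dot_sumr linear_sum.
  apply: eq_bigr => a _; rewrite dotZr linearZ -!tnth_nth image_rieszE //.
rewrite (coord_vbasis (memvf y)) big1 // => i _.
have := y0 (linfun (coord (vbasis {:F}) i : F -> K^o)).
by rewrite lfunE /= => ->; rewrite scale0r.
Qed.

(** The constant gamma of the overview; the weights [x] do not enter it. *)
Definition image_gram : K := \det (gram_mx ipF image_riesz).

Lemma image_gram_neq0 : image_gram != 0.
Proof.
by have := gram_unitmx ipF image_riesz_free; rewrite unitmxE unitfE.
Qed.

Variables (x : 'I_s -> R) (ipE : {dot 'Hom(E, K^o) for conj}).
Hypotheses (hx : forall i, 0 < x i) (hw : weighted_dot e x ipE).

Local Notation d := (transpose del).
Local Notation dstar := (adjoint ipF ipE d).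

(** The Riesz vector of evaluation at [del e_i]. The adjoint of d sends the i-th dual basis vector
    to [x_i] times it. *)
Let sigma i := \sum_a conj (C a i) *: tnth image_riesz a.

Let sigmaE i v : ipF v (sigma i) = v (del (tnth e i)).
Proof.
rewrite dot_sumr (coord_vbasis (memv_img del (memvf (tnth e i)))) linear_sum.
apply: eq_bigr => a _; rewrite dotZr image_rieszE linearZ scalar_conjK mxE.
by rewrite -tnth_nth.
Qed.

Lemma weighted_dotE v i :
  ipE v (tnth (dual_basis e) i) = v (tnth e i) * of_real c (x i).
Proof.
rewrite {1}(dual_basis_sum he v) dot_suml (bigD1 i) // big1.
  by rewrite dotZl hw eqxx; apply: addr0.
by move=> j /negPf ji; rewrite dotZl hw ji mulr0.
Qed.

(** [adjoint] is a choice with default 0, so an adjoint must be exhibited: it is defined on the dual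
    basis through [sigma] and extended linearly. *)
Lemma adjointE v w : ipF v (dstar w) = ipE (d v) w.
Proof.
suff ex : exists h : 'Hom('Hom(E, K^o), 'Hom(F, K^o)),
  forall v w, ipF v (h w) = ipE (d v) w by exact: (xgetPex 0 ex).
have [h hE] := linear_of_free (dual_basis e)
  [seq of_real c (x i) *: sigma i | i <- enum 'I_s].
have {}hE i : h (tnth (dual_basis e) i) = of_real c (x i) *: sigma i.
  have := hE (dual_basis_free he); rewrite !size_map => /(_ erefl).
  move/(congr1 (fun z => nth 0 z i)).
  rewrite (nth_map 0) ?size_tuple // -tnth_nth => ->.
  by rewrite (nth_map i) ?size_enum_ord // nth_ord_enum.
exists (linfun h) => v' w'; rewrite lfunE /= (dual_basis_sum he w') linear_sum.
rewrite !dot_sumr; apply: eq_bigr => i _.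
rewrite linearZ !dotZr hE dotZr sigmaE weighted_dotE transposeE scalar_conj_real.
by rewrite [of_real c _ * _]mulrC.
Qed.

Lemma orth_proj_dual_span (T : {set 'I_s}) (u : 'Hom(E, K^o)) :
  orth_proj ipE (span_on (dual_basis e) T) u =
    \sum_(t < #|T|) (ipE u (tnth (dual_basis e) (enum_val t))
        / of_real c (x (enum_val t))) *: tnth (dual_basis e) (enum_val t).
Proof.
apply: orth_projE.
  apply: rpred_sum => t _; apply: rpredZ; apply: mem_dual_span; exact: enum_valP.
set h := \sum_(t < _) _; move=> v vT.
suff : (span_on (dual_basis e) T <= orthov ipE <[u - h]>)%VS.
  by move/subvP/(_ _ vT); rewrite mem_orthov1 => /eqP uv; rewrite dotC uv rmorph0.
apply/span_subvP => _ /mapP[i iT ->]; rewrite mem_enum in iT.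
rewrite mem_orthov1; apply/eqP; apply: (etrans (dotC ipE _ _)); rewrite dotBl.
rewrite -(enum_rankK_in iT iT); set j := enum_rank_in iT i.
rewrite dot_suml (bigD1 j) // big1 => [|t /negPf tj].
  rewrite dotZl hw eqxx divfK; last by rewrite fmorph_eq0 gt_eqF.
  by rewrite [X in _ - X]addr0 subrr rmorph0.
by rewrite dotZl hw (inj_eq enum_val_inj) tj mulr0.
Qed.

(** The (t, t') entry of the compression is [x_t x_t'] times the product of [sigma t] and
    [sigma t'], divided by the squared norm [x_t']. So each row t carries a factor [x_t], and what
    remains is free of the weights. *)
Lemma det_compression (T : {set 'I_s}) :
  lfun_det (compression ipE (span_on (dual_basis e) T) (d \o dstar)%VF) =
  of_real c (setprod x T) *
    \det (principal_submx T
      ((map_mx conj C)^T *m gram_mx ipF image_riesz *m C)).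
Proof.
rewrite (lfun_det_basis _ (dual_span_tuple_basis he T)).
set M := principal_submx _ _.
transitivity (\det (diag_mx (\row_(t < #|T|) of_real c (x (enum_val t))) *m M)).
  congr (\det _); apply/matrixP => t t'; rewrite mul_diag_mx.
  rewrite !mxE compressionE vsval_dual_span comp_lfunE orth_proj_dual_span linear_sum.
  rewrite (eq_bigr (fun r => (ipE (d (dstar (tnth (dual_basis e) (enum_val t))))
    (tnth (dual_basis e) (enum_val r)) / of_real c (x (enum_val r)))
      *: (dual_span_tuple e T)`_r)); last first.
    move=> r _; rewrite -tnth_nth [tnth (dual_span_tuple _ _) _]tnth_mktuple.
    exact: linearZ.
  rewrite coord_sum_free ?(basis_free (dual_span_tuple_basis he T)) //.
  rewrite -adjointE.
  have dstarE i : dstar (tnth (dual_basis e) i) = of_real c (x i) *: sigma i.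
    apply/eqP; rewrite -subr_eq0; apply/eqP; apply: (dot_eq0 (ip := ipF)).
    set z := _ - _; rewrite [in X in ipF _ X]/z dotBr dotZr scalar_conj_real.
    rewrite adjointE sigmaE weighted_dotE transposeE mulrC; exact: subrr.
  rewrite !dstarE dotZl dotZr scalar_conj_real.
  rewrite [of_real c (x (enum_val t')) * _]mulrC mulrA mulfK; last first.
    by rewrite fmorph_eq0 gt_eqF.
  congr (_ * _); rewrite dot_sumr; apply: eq_bigr => b _; rewrite dotZr scalar_conjK.
  rewrite mulrC [C _ _]mxE; congr (_ * _).
  rewrite !mxE dot_suml; apply: eq_bigr => a _; rewrite dotZl !mxE //.
rewrite det_mulmx det_diag; congr (_ * _).
rewrite /setprod rmorph_prod [RHS]big_enum_val /=.
by apply: eq_bigr => t _; rewrite mxE.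
Qed.

End BasisWeights.

(** * Evaluation minors *)

Lemma big_enum_cast (V : Type) (idx : V) (op : Monoid.com_law idx) s r
    (A : {set 'I_s}) (hA : #|A| = r) (f : 'I_s -> V) :
  \big[op/idx]_(i in A) f i = \big[op/idx]_(a < r) f (enum_cast hA a).
Proof.
subst r; rewrite big_enum_val; apply: eq_bigr => a _.
by rewrite /enum_cast cast_ord_id.
Qed.

Section EvaluationMinors.
Variables (K : fieldType) (E F : vectType K) (s : nat) (e : s.-tuple E).
Variables (del : 'Hom(E, F)) (k : nat) (th : k.-tuple 'Hom(E, K^o)).
Hypothesis he : basis_of {:E} e.

Local Notation n := (\dim (limg del)).
Local Notation beta := (vbasis (limg del)).

Definition th_mx : 'M[K]_(k, s) := \matrix_(l, i) (tnth th l (tnth e i) : K).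

(** The matrix M of the overview: the values on the [e_i] of the basis mu of H, before any scaling
    by the weights. *)
Definition eval_mx : 'M[K]_(n + k, s) := col_mx (image_mx e del) th_mx.

Local Notation C := (image_mx e del).
Local Notation M := eval_mx.

Lemma eval_mxE a i :
  M a i = tnth (cat_tuple (image_functionals del) th) a (tnth e i).
Proof.
rewrite mxE -[a in RHS]fintype.splitK; case: (fintype.split a) => b /=; rewrite mxE.
  by rewrite tnth_lshift image_functionalsE.
by rewrite tnth_rshift.
Qed.

(* In the columns indexed by [A :\: T], replacing e_j by its projection to
   ker del is a unipotent column operation that kills the upper block. *)
Lemma det_eval_mx (A T : {set 'I_s}) (hA : #|A| = (n + k)%N) (hT : #|T| = n) :
    matroid_basis e del T -> T \subset A ->
  exists b : bool, \det (colsub (enum_cast hA) M) =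
    (-1) ^+ b * (\det (colsub (enum_cast hT) C)
                 * wedge_pairing th (kernel_basis e del A T)).
Proof.
move=> TB TA; have hB : #|A :\: T| = k.
  by apply/eqP; rewrite -(eqn_add2l n) -hA -{1}hT -(cardsID T A) (finset.setIidPr TA).
(* The enumeration of [A] that lists [T] first and then [A :\: T]; it differs from the increasing
   one by a permutation. *)
pose f (i : 'I_(n + k)) :=
  match fintype.split i with inl a => enum_cast hT a | inr b => enum_cast hB b end.
have fl a : f (lshift k a) = enum_cast hT a.
  by rewrite /f -[lshift k a]/(unsplit (inl a)) fintype.unsplitK.
have fr b : f (rshift n b) = enum_cast hB b.
  by rewrite /f -[rshift n b]/(unsplit (inr b)) fintype.unsplitK.
have T_B a b : enum_cast hT a <> enum_cast hB b.
  move=> ab; have := enum_castP hB b.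
  by rewrite -ab inE (enum_castP hT).
have f_inj : injective f.
  move=> i j; rewrite -(fintype.splitK i) -(fintype.splitK j).
  case: (fintype.split i) (fintype.split j) => [a|b] [a'|b'] /=; rewrite ?fl ?fr.
  - by move/enum_cast_inj ->.
  - by move/T_B.
  - by move/esym/T_B.
  - by move/enum_cast_inj ->.
have fA i : exists j, f i = enum_cast hA j.
  apply: enum_cast_surj; rewrite -(fintype.splitK i); case: (fintype.split i) => [a|b].
    by rewrite fl (fintype.subsetP TA) // enum_castP.
  by rewrite fr; have := enum_castP hB b; rewrite inE => /andP[].
have [b detE] := det_colsub_reorder M f_inj fA.
exists b; apply: (canRL (signrMK b)); rewrite -detE.
pose z l := kernel_proj e del T (tnth e (enum_cast hB l)).
(* By [kernel_projE], column l of [S] expresses [e_j - z l], with j the l-th element of [A :\: T],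
   through the [e_i], i in T. *)
pose S : 'M[K]_(n, k) := \matrix_(a, l)
  coord e (enum_cast hT a) (tnth e (enum_cast hB l) - z l).
have eE l : tnth e (enum_cast hB l) = z l + \sum_a S a l *: tnth e (enum_cast hT a).
  rewrite {1}(kernel_projE he (enum_cast hB l) TB) (big_enum_cast _ hT).
  by congr (_ + _); apply: eq_bigr => a _; rewrite mxE.
have CB : colsub (enum_cast hB) C = colsub (enum_cast hT) C *m S.
  apply/matrixP => a l; rewrite mxE mxE [RHS]mxE.
  have -> : del (tnth e (enum_cast hB l)) =
      \sum_a' S a' l *: del (tnth e (enum_cast hT a')).
    rewrite eE linearD /= kernel_proj_ker add0r linear_sum.
    by apply: eq_bigr => a' _; rewrite linearZ.
  rewrite linear_sum; apply: eq_bigr => a' _.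
  by rewrite linearZ /= mulrC [colsub _ _ _ _]mxE [C _ _]mxE.
have TB_mx : colsub (enum_cast hB) th_mx =
    \matrix_(i, j) (tnth th i (z j) : K) + colsub (enum_cast hT) th_mx *m S.
  apply/matrixP => i l; rewrite mxE mxE [RHS]mxE [X in X + _]mxE [X in _ + X]mxE.
  rewrite eE linearD linear_sum; congr (_ + _); apply: eq_bigr => a _.
  by rewrite linearZ [colsub _ _ _ _]mxE [th_mx _ _]mxE; apply: mulrC.
have fE : colsub f M *m block_mx 1%:M (- S) 0 1%:M =
    block_mx (colsub (enum_cast hT) C) 0 (colsub (enum_cast hT) th_mx)
      (\matrix_(i, j) (tnth th i (z j) : K)).
  have -> : colsub f M =
      block_mx (colsub (enum_cast hT) C) (colsub (enum_cast hB) C)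
        (colsub (enum_cast hT) th_mx) (colsub (enum_cast hB) th_mx).
    apply/matrixP => i j; rewrite -(fintype.splitK i) -(fintype.splitK j) mxE.
    case: (fintype.split i) (fintype.split j) => [a|b'] [a'|b''] /=.
    - by rewrite fl /eval_mx col_mxEu block_mxEul [RHS]mxE.
    - by rewrite fr /eval_mx col_mxEu block_mxEur [RHS]mxE.
    - by rewrite fl /eval_mx col_mxEd block_mxEdl [RHS]mxE.
    - by rewrite fr /eval_mx col_mxEd block_mxEdr [RHS]mxE.
  rewrite mulmx_block !mulmx1 !mulmx0 !addr0 !mulmxN CB TB_mx addNr.
  by rewrite addrCA addNr addr0.
have := congr1 (fun M => \det M) fE.
rewrite det_mulmx det_ublock !det1 !mulr1 det_lblock => ->; congr (_ * \det _).
apply/matrixP => i j; rewrite !mxE; congr (tnth th i _).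
have jB : (j < #|A :\: T|)%N by rewrite hB.
by rewrite (nth_map (enum_cast hB j)) -?cardE // /z {1}/enum_cast
  (enum_val_nth (enum_cast hB j)).
Qed.

(** By contradiction: if the images of [A] span only a proper subspace [U], the upper block factors
    through [U], so its rows are dependent. Such a dependency, extended by zero, lies in the left
    kernel of the whole minor. *)
Lemma det_eval_mx_neq0 (A : {set 'I_s}) (hA : #|A| = (n + k)%N) :
  \det (colsub (enum_cast hA) M) != 0 -> A \in matroid_bases_up e del k.
Proof.
rewrite -unitfE -unitmxE => M_unit; rewrite inE hA eqxx /=.
suff /matroid_basis_within[T TB TA] :
    <<[seq del (tnth e i) | i <- enum A]>>%VS = limg del.
  by apply/existsP; exists T; rewrite TB.
apply/eqP; rewrite eqEdim span_imgs_sub leqNgt /=; apply/negP.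
set U := <<_>>%VS => Un.
pose B : 'M[K]_(n, \dim U) := \matrix_(a, l) coord beta a (vbasis U)`_l.
pose D : 'M[K]_(\dim U, n + k) :=
  \matrix_(l, j) coord (vbasis U) l (del (tnth e (enum_cast hA j))).
have BD : colsub (enum_cast hA) C = B *m D.
  apply/matrixP => a j; rewrite !mxE.
  have jU : del (tnth e (enum_cast hA j)) \in U.
    by apply: memv_span; apply/mapP; exists (enum_cast hA j);
      rewrite ?mem_enum ?enum_castP.
  rewrite {1}(coord_vbasis jU) linear_sum; apply: eq_bigr => l _.
  by rewrite linearZ !mxE; exact: mulrC.
have : kermx B != 0.
  rewrite kermx_eq0 /row_free neq_ltn; apply/orP; left.
  exact: leq_ltn_trans (rank_leq_col B) Un.
case/rowV0Pn => v /sub_kermxP vB; apply/negP; rewrite negbK.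
have vM : row_mx v 0 *m colsub (enum_cast hA) M = 0.
  have -> : colsub (enum_cast hA) M =
      col_mx (colsub (enum_cast hA) C) (colsub (enum_cast hA) th_mx).
    apply/matrixP => i j; rewrite -(fintype.splitK i) mxE; case: (fintype.split i) => b /=.
      by rewrite /eval_mx !col_mxEu [RHS]mxE.
    by rewrite /eval_mx !col_mxEd [RHS]mxE.
  by rewrite mul_row_col mul0mx addr0 BD mulmxA vB mul0mx.
have := mulmxK M_unit (row_mx v 0); rewrite vM mul0mx => /esym/eqP.
by rewrite row_mx_eq0 => /andP[].
Qed.

End EvaluationMinors.

(** * Random finite subsets *)

Section FiniteDistributions.
Variables (R : realFieldType) (s : nat) (q : {set 'I_s} -> R) (r : nat).

(** The sum of [q A * (r - #|A|)] vanishes by the mean and has no negative term by the size bound,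
    so every term is zero and [q] lives on sets of size [r]. *)
Lemma card_concentration :
    (forall A, 0 <= q A) -> \sum_A q A = 1 ->
    (forall A : {set 'I_s}, (r < #|A|)%N ->
      \sum_(B : {set 'I_s} | A \subset B) q B = 0) ->
    \sum_i \sum_(B : {set 'I_s} | [set i] \subset B) q B = r%:R ->
  forall A : {set 'I_s},
    q A = if #|A| == r then \sum_(B : {set 'I_s} | A \subset B) q B else 0.
Proof.
move=> q_ge0 q1 q_large q_mean.
have q0 (A : {set 'I_s}) : (r < #|A|)%N -> q A = 0.
  move=> /q_large /psumr_eq0P; apply=> //.
have mean0 : \sum_A q A * (r%:R - #|A|%:R) = 0.
  rewrite (eq_bigr _ (fun A _ => mulrBr _ _ _)) sumrB -mulr_suml q1 mul1r -q_mean.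
  apply/eqP; rewrite subr_eq0; apply/eqP.
  (* After the exchange, each [q B] is counted once for every element of [B]. *)
  rewrite (exchange_big_dep xpredT) //=; apply: eq_bigr => B _.
  rewrite sumr_const mulr_natr; congr (_ *+ _); apply: eq_card => i.
  by rewrite unfold_in finset.sub1set.
have terms0 (A : {set 'I_s}) : q A * (r%:R - #|A|%:R) = 0.
  move/psumr_eq0P: mean0; apply=> // B _; case: (leqP #|B| r) => Br.
    by rewrite mulr_ge0 // subr_ge0 ler_nat.
  by rewrite q0 // mul0r.
move=> A; case: (eqVneq #|A| r) => [Ar | /negPf Ar].
  rewrite (bigD1 A) //= big1 ?addr0 // => B /andP[AB BA]; apply: q0.
  by rewrite -Ar; apply: proper_card; rewrite finset.properEneq eq_sym BA.
have /eqP := terms0 A; rewrite mulf_eq0 subr_eq0 eqr_nat.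
by rewrite [r == _]eq_sym Ar orbF => /eqP.
Qed.

End FiniteDistributions.

(** * Probabilities of events as finite sums of point masses *)

Section RandomFiniteSubset.
Variables (R : realType) (disp : measure_display) (Omega : measurableType disp).
Variables (P : probability Omega R) (s : nat) (Y : Omega -> {set 'I_s}).
Hypothesis hY : random_subset Y.

Lemma prob_finE (Q : pred {set 'I_s}) :
  P [set w | Q (Y w)]%classic = (fine (P [set w | Q (Y w)]%classic))%:E.
Proof.
by rewrite fineK //; apply: fin_num_measure; exact: (hY [set A | Q A]%classic).
Qed.

Lemma prob_pred_sum (Q : pred {set 'I_s}) :
  fine (P [set w | Q (Y w)]%classic) =
    \sum_(B | Q B) fine (P [set w | Y w = B]%classic).
Proof.
have mY B : measurable [set w | Y w = B]%classic by exact: (hY [set B]%classic).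
pose D := [set` [seq B <- enum {set 'I_s} | Q B]]%classic.
have -> : [set w | Q (Y w)]%classic = (\bigcup_(B in D) [set w | Y w = B])%classic.
  apply/seteqP; split=> w /=.
    by move=> QY; exists (Y w) => //=; rewrite /D /= mem_filter QY mem_enum.
  by case=> B; rewrite /D /= mem_filter => /andP[QB _] ->.
rewrite measure_fin_bigcup //; last first.
- by move=> B B' _ _ [w [/= -> ->]].
- exact: finite_seq.
rewrite /D -fsbig_seq; last by apply: filter_uniq; exact: enum_uniq.
rewrite -sum_fine; last by move=> B _; exact: fin_num_measure.
by rewrite big_filter big_enum_cond; apply: eq_bigl => B; rewrite ?inE.
Qed.

End RandomFiniteSubset.

(** * The determinantal law *)

Section DeterminantalMinors.
Variables (R : realType) (c : real_or_complex).
Local Notation K := (scalars R c).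
Local Notation conj := (scalar_conj R c).
Variables (E F : vectType K) (s : nat) (e : s.-tuple E) (del : 'Hom(E, F)).
Hypothesis he : basis_of {:E} e.
Variable ipF : {dot 'Hom(F, K^o) for conj}.
Variables (x : 'I_s -> R) (ipE : {dot 'Hom(E, K^o) for conj}).
Hypotheses (hx : forall i, 0 < x i) (hw : weighted_dot e x ipE).
Variables (k : nat) (th : k.-tuple 'Hom(E, K^o)).

Local Notation n := (\dim (limg del)).
Local Notation sqnorm z := (z * conj z).
Local Notation minor hA := (\det (colsub (enum_cast hA) (eval_mx e del th))).

Lemma setprod_gt0 (A : {set 'I_s}) : 0 < setprod x A.
Proof. by apply: prodr_gt0 => i _. Qed.

(** [basis_weight] is a choice: [det_compression] shows that the candidate works for all weights,
    and uniqueness is tested at the given [x] and [ipE], where [setprod x T] can be cancelled. *)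
Lemma of_real_basis_weight (T : {set 'I_s}) (hT : #|T| = n) :
  of_real c (basis_weight e del ipF T) =
    image_gram del ipF * sqnorm (\det (colsub (enum_cast hT) (image_mx e del))).
Proof.
set D := \det _; have [g gE] : exists g, image_gram del ipF = of_real c g.
  by apply: scalar_conj_fix; exact: det_gram_conj.
rewrite gE -modulus_sqr -rmorphM; congr of_real.
apply: xget_unique => [x' ip' hx' hw' | r rP].
  rewrite /= (det_compression del he ipF hx' hw') (det_principal_sandwich _ _ _ hT) -/D.
  by rewrite -/(image_gram del ipF) gE -modulus_sqr -!rmorphM mulrC.
have := rP x ipE hx hw; rewrite /= (det_compression del he ipF hx hw).
rewrite (det_principal_sandwich _ _ _ hT) -/D.
rewrite -/(image_gram del ipF) gE -modulus_sqr -!rmorphM mulrC => /of_real_inj.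
by move/esym/mulIf; apply; rewrite gt_eqF // setprod_gt0.
Qed.

(** The right-hand side does not involve [T]: this is the independence of w(A) from the chosen
    basis. The sign of [det_eval_mx] disappears against its conjugate. *)
Lemma of_real_weight_minor (A T : {set 'I_s}) (hA : #|A| = (n + k)%N) :
  matroid_basis e del T -> T \subset A ->
  of_real c (basis_weight e del ipF T
             * modulus (wedge_pairing th (kernel_basis e del A T)) ^+ 2) =
    image_gram del ipF * sqnorm (minor hA).
Proof.
move=> TB TA; have hT := card_matroid_basis he TB.
have [b ->] := det_eval_mx th he hA hT TB TA.
rewrite of_realM of_real_basis_weight modulus_sqr -mulrA; congr (_ * _).
by rewrite !rmorphM rmorph_sign [LHS]mulrACA [RHS]mulrACA -signr_addb addbb mul1r.
Qed.

Lemma of_real_up_weight (A : {set 'I_s}) (hA : #|A| = (n + k)%N) :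
  A \in matroid_bases_up e del k ->
  of_real c (up_weight e del ipF th A) = image_gram del ipF * sqnorm (minor hA).
Proof.
rewrite inE => /andP[_ /existsP[T0 T0P]]; rewrite /up_weight.
case: pickP => [T /andP[TB TA] | /(_ T0)]; last by rewrite T0P.
exact: of_real_weight_minor.
Qed.

Local Notation b := (normalized_dual_basis e x).
Let sqrtx i : K := of_real c (Num.sqrt (x i)).

Let sqrtx_neq0 i : sqrtx i != 0.
Proof. by rewrite fmorph_eq0 gt_eqF // sqrtr_gt0. Qed.

Lemma dot_normalizedE v i : ipE v (tnth b i) = v (tnth e i) * sqrtx i.
Proof.
rewrite tnth_mktuple dotZr (weighted_dotE he hw) fmorphV scalar_conj_real.
by rewrite mulrCA -{2}(sqr_sqrtr (ltW (hx i))) expr2 of_realM mulKf // sqrtx_neq0.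
Qed.

Lemma normalized_orthonormal i j : ipE (tnth b i) (tnth b j) = (i == j)%:R.
Proof.
rewrite dot_normalizedE tnth_mktuple scale_lfunE (dual_basis_tnth he).
transitivity ((sqrtx i)^-1 * (j == i)%:R * sqrtx j) => //.
have [-> | _] := eqVneq j i; last by rewrite mulr0 mul0r.
by rewrite mulr1 mulVf.
Qed.

Lemma normalized_basis : basis_of {:'Hom(E, K^o)} b.
Proof.
rewrite basisEfree subvf; apply/and3P; split=> //.
  apply/freeP => l sum0 j.
  have <- : ipE (\sum_i l i *: b`_i) (tnth b j) = 0 by rewrite sum0 dotC dot0r rmorph0.
  rewrite dot_suml (bigD1 j) // big1 => [|i ij].
    by rewrite dotZl -tnth_nth normalized_orthonormal eqxx mulr1; apply/esym/addr0.
  by rewrite dotZl -tnth_nth normalized_orthonormal (negPf ij) mulr0.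
by rewrite (size_basis (dual_basis_basis he)) size_tuple.
Qed.

Variable H : {vspace 'Hom(E, K^o)}.
Local Notation mu := (cat_tuple (image_functionals del) th).
Hypothesis muH : basis_of H mu.

Local Notation proj_mx := (orth_proj_mx ipE b H).
Let N := \matrix_(a < n + k, i < s) coord b i (tnth mu a).

Let NE : N = eval_mx e del th *m diag_mx (\row_i sqrtx i).
Proof.
apply/matrixP => a i; rewrite mul_mx_diag [LHS]mxE [RHS]mxE.
rewrite (coord_orthonormal _ _ normalized_basis normalized_orthonormal).
by rewrite dot_normalizedE eval_mxE [(\row_ _ _) _ _]mxE.
Qed.

Let projE := orth_proj_mxE muH normalized_basis normalized_orthonormal.

Definition functionals_gram : K := \det (gram_mx ipE mu).

Lemma functionals_gram_neq0 : functionals_gram != 0.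
Proof. by have := gram_unitmx ipE (basis_free muH); rewrite unitmxE unitfE. Qed.

(** Passing from M to N scales column i by the square root of [x i], which is real, so the minor
    times its conjugate gains exactly [setprod x A]. *)
Lemma proj_minor (A : {set 'I_s}) (hA : #|A| = (n + k)%N) :
  \det (principal_submx A proj_mx) =
    functionals_gram^-1 * (sqnorm (minor hA) * of_real c (setprod x A)).
Proof.
rewrite -det_tr_principal (proj1 projE) (det_principal_sandwich _ _ _ hA) det_inv.
congr (_ * _); rewrite -/N.
have -> : \det (colsub (enum_cast hA) N) = minor hA * \prod_(i in A) sqrtx i.
  have -> : colsub (enum_cast hA) N = colsub (enum_cast hA) (eval_mx e del th)
      *m diag_mx (\row_a sqrtx (enum_cast hA a)).
    by rewrite NE; apply/matrixP => a i; rewrite mul_mx_diag mxE mul_mx_diag !mxE.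
  rewrite det_mulmx det_diag; congr (_ * _).
  by rewrite (big_enum_cast _ hA); apply: eq_bigr => a _; rewrite mxE.
rewrite rmorphM mulrACA; congr (_ * _); rewrite rmorph_prod -big_split rmorph_prod.
apply: eq_bigr => i _; rewrite /= scalar_conj_real -rmorphM -expr2 sqr_sqrtr //.
exact: ltW.
Qed.

Lemma proj_minor_large (A : {set 'I_s}) : (n + k < #|A|)%N ->
  \det (principal_submx A proj_mx) = 0.
Proof.
by move=> lA; rewrite -det_tr_principal (proj1 projE) det_principal_mulmx0.
Qed.

(** By cyclicity the trace is that of the inverse Gram matrix times the Gram matrix, of size
    [n + k]. *)
Lemma proj_trace : \tr proj_mx = (n + k)%:R.
Proof.
have GU := gram_unitmx ipE (basis_free muH).
rewrite -mxtrace_tr (proj1 projE) -mulmxA mxtrace_mulC -mulmxA.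
by rewrite -(proj2 projE) mulVmx // mxtrace1.
Qed.

Variables (disp : measure_display) (Omega : measurableType disp).
Variables (P : probability Omega R) (Y : Omega -> {set 'I_s}).
Hypothesis hY : determinantal P Y ipE b H.

Let q A := fine (P [set w | Y w = A]%classic).

Let q_ge0 A : 0 <= q A.
Proof. exact/fine_ge0/measure_ge0. Qed.

Let q_total : \sum_A q A = 1.
Proof.
rewrite -(prob_pred_sum P (proj1 hY) xpredT).
transitivity (fine (P [set: Omega]%classic)); last by rewrite probability_setT.
by congr (fine (P _)); apply/seteqP; split.
Qed.

Let q_incl (J : {set 'I_s}) :
  of_real c (\sum_(B : {set 'I_s} | J \subset B) q B)
    = \det (principal_submx J proj_mx).
Proof.
by rewrite -(prob_pred_sum P (proj1 hY) (fun B => J \subset B)) (proj2 hY).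
Qed.

Lemma determinantal_card (A : {set 'I_s}) :
  q A = if #|A| == (n + k)%N then \sum_(B : {set 'I_s} | A \subset B) q B else 0.
Proof.
apply: card_concentration => // [B lB|].
  by apply: (@of_real_inj R c); rewrite q_incl proj_minor_large // rmorph0.
apply: (@of_real_inj R c); rewrite rmorph_sum rmorph_nat -proj_trace.
by apply: eq_bigr => i _; apply: etrans (q_incl _) _; rewrite det_principal1.
Qed.

Lemma determinantal_out A : A \notin matroid_bases_up e del k -> q A = 0.
Proof.
move=> A_out; rewrite determinantal_card; case: eqP => // hA.
apply: (@of_real_inj R c); rewrite q_incl (proj_minor hA).
have /eqP -> : minor hA == 0 by apply: contraNT A_out; exact: det_eval_mx_neq0.
by rewrite !mul0r mulr0 rmorph0.
Qed.

Lemma determinantal_weights : exists2 g : R, g != 0 &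
  forall A, A \in matroid_bases_up e del k ->
    q A * g = up_weight e del ipF th A * setprod x A.
Proof.
(* The constant is the product of the two Gram determinants, the same for every [A]. *)
have [g gE] : exists g, functionals_gram * image_gram del ipF = of_real c g.
  by apply: scalar_conj_fix; rewrite rmorphM !det_gram_conj.
exists g; first by rewrite -(of_real_neq0 c) -gE mulf_neq0
  ?functionals_gram_neq0 ?image_gram_neq0.
move=> A AB; have /andP[/eqP hA _] : (#|A| == (n + k)%N) && true.
  by move: AB; rewrite inE => /andP[->].
apply: (@of_real_inj R c); rewrite determinantal_card hA eqxx !of_realM q_incl.
rewrite (proj_minor hA) -gE (of_real_up_weight hA AB) mulrA.
by rewrite [_ * functionals_gram]mulrC mulVKf ?functionals_gram_neq0 // mulrC mulrA.
Qed.

(** Summing the proportionality over all sets identifies its constant with [partition_sum]: the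
    total mass is 1 and sets outside [matroid_bases_up] carry none. *)
Lemma determinantal_law A : A \in matroid_bases_up e del k ->
  q A = up_weight e del ipF th A * setprod x A / partition_sum e del ipF th x.
Proof.
have [g g0 qE] := determinantal_weights.
have -> : partition_sum e del ipF th x = g.
  rewrite /partition_sum -(eq_bigr _ qE) -mulr_suml -[RHS]mul1r -q_total.
  congr (_ * _); rewrite [RHS](bigID (mem (matroid_bases_up e del k))) /=.
  by rewrite [X in _ + X]big1 ?addr0 // => A0; exact: determinantal_out.
by move=> AB; rewrite -(qE A AB) mulfK.
Qed.

End DeterminantalMinors.

(** These functionals span [H] and are as many as its dimension. *)
Lemma functionals_basis (K : fieldType) (E F : vectType K) (del : 'Hom(E, F))
    (k : nat) (H : {vspace 'Hom(E, K^o)}) (th : k.-tuple 'Hom(E, K^o)) :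
    \dim H = (\dim (limg (transpose del)) + k)%N ->
    H = (limg (transpose del) + <<th>>)%VS ->
  basis_of H (cat_tuple (image_functionals del) th).
Proof.
move=> dimH defH; rewrite basisEdim size_tuple dimH.
rewrite (size_basis (image_functionals_basis del)) leqnn andbT.
by rewrite defH span_cat (span_basis (image_functionals_basis del)).
Qed.

Theorem theorem13p13
    (R : realType) (c : real_or_complex)
    (E F : vectType (scalars R c)) (s : nat)
    (e : s.-tuple E) (he : basis_of {:E} e)
    (del : 'Hom(E, F))
    (ipF : {dot 'Hom(F, (scalars R c)^o) for scalar_conj R c})
    (ipE : {dot 'Hom(E, (scalars R c)^o) for scalar_conj R c})
    (x : 'I_s -> R) (hx : forall i, 0 < x i)
    (hipE : weighted_dot e x ipE)
    (k : nat)
    (H : {vspace 'Hom(E, (scalars R c)^o)})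
    (hdH : (limg (transpose del) <= H)%VS)
    (hdimH : \dim H = (\dim (limg (transpose del)) + k)%N)
    (th : k.-tuple 'Hom(E, (scalars R c)^o))
    (hHsum : H = (limg (transpose del) + <<th>>)%VS)
    (hHdirect : directv (limg (transpose del) + <<th>>))
    (disp : measure_display) (Omega : measurableType disp)
    (P : probability Omega R) (Y : Omega -> {set 'I_s})
    (hY : determinantal P Y ipE (normalized_dual_basis e x) H) :
  {ae P, forall w, Y w \in matroid_bases_up e del k} /\
  forall A : {set 'I_s}, A \in matroid_bases_up e del k ->
    P [set w | Y w = A]%classic
      = (up_weight e del ipF th A * setprod x A
          / partition_sum e del ipF th x)%:E /\
    forall T : {set 'I_s}, matroid_basis e del T -> T \subset A ->
      P [set w | Y w = A]%classic
        = (basis_weight e del ipF T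
            * modulus (wedge_pairing th (kernel_basis e del A T)) ^+ 2
            * setprod x A
            / partition_sum e del ipF th x)%:E.
Proof.
have muH := functionals_basis hdimH hHsum.
have probE A : P [set w | Y w = A]%classic = (fine (P [set w | Y w = A]%classic))%:E.
  have := prob_finE P (proj1 hY) (pred1 A).
  by rewrite (_ : [set w | pred1 A (Y w)]%classic = [set w | Y w = A]%classic) //;
    apply/seteqP; split=> w /= /eqP.
split.
  exists [set w | Y w \notin matroid_bases_up e del k]%classic; split => //.
  - exact: (proj1 hY) [set A | A \notin matroid_bases_up e del k]%classic.
  - pose Q A := A \notin matroid_bases_up e del k.
    apply: etrans (prob_finE P (proj1 hY) Q) _.
    rewrite (prob_pred_sum P (proj1 hY) Q) big1 // => A.
    exact: (determinantal_out he hx hipE muH hY).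
  - by move=> w /= /negP.
move=> A AB; have lawA := determinantal_law he ipF hx hipE muH hY AB.
split=> [|T TB TA]; rewrite probE lawA //; congr ((_ * _ / _)%:E).
have /eqP hA : #|A| == (\dim (limg del) + k)%N by move: AB; rewrite inE => /andP[].
(* The weight from the picked basis and the one from [T] both equal gamma times the same minor
   multiplied by its conjugate. *)
apply: (@of_real_inj R c); rewrite (of_real_up_weight he ipF hx hipE th hA AB).
by rewrite (of_real_weight_minor he ipF hx hipE th hA TB TA).
Qed.
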